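(* Let $(L,h)$ and $(N,g)$ be pseudo-Riemannian manifolds, let $w:L\to(0,\infty)$ be a smooth function, and let $M=L\times_w N$ be the warped product. Let $f:N\to N$ be a diffeomorphism and let $\bar f:L\times N\to L\times N$, $\bar f(x,y)=(x,f(y))$, be its trivial extension. Then $\bar f$ is an isometry of $L\times_w N$ if and only if $f$ is an isometry of $(N,g)$.
   Context: The warped product $L\times_w N$ is the product manifold $L\times N$ endowed with the pseudo-Riemannian metric $h\oplus w g$, i.e. at $(x,y)$ the metric is $h_x\oplus w(x)g_y$. *)

(* Defs.v *)
From HB Require Import structures.
From mathcomp Require Import all_boot all_order all_algebra.
From mathcomp Require Import all_classical all_reals all_analysis.
Import Order.TTheory GRing.Theory Num.Theory.
Import numFieldNormedType.Exports.

Set Implicit Arguments.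
Unset Strict Implicit.
Unset Printing Implicit Defensive.

Local Open Scope classical_set_scope.
Local Open Scope ring_scope.

(* [Ck k U f] is only meant for open [U] and finite-dimensional [V]: there, f  *)
(* is C^(k+1) iff it is differentiable and all the maps x |-> df_x(v), v fixed,*)
(* are C^k.                                                                    *)
Fixpoint Ck (R : realType) (V W : normedModType R) (k : nat) (U : set V)
    (f : V -> W) : Prop :=
  if k is k'.+1 then
    (forall x, U x -> differentiable f x) /\
    (forall v, Ck k' U (fun x => 'd f x v))
  else forall x, U x -> {for x, continuous f}.

Definition smooth_on (R : realType) (V W : normedModType R) (U : set V)
  (f : V -> W) : Prop := forall k, Ck k U f.

(* The values of [cfun] outside [cdom] and of [cinv] outside the image of the  *)
(* chart are irrelevant.                                                       *)
Record chart (R : realType) (T : topologicalType) (n : nat) := Chart {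
  cfun :> T -> 'rV[R]_n ;
  cinv : 'rV[R]_n -> T ;
  cdom : set T ;
  cdom_open : open cdom ;
  cimg_open : open (cfun @` cdom) ;
  cfunK : forall p, cdom p -> cinv (cfun p) = p ;
  cfun_continuous : forall p, cdom p -> {for p, continuous cfun} ;
  cinv_continuous : forall z, (cfun @` cdom) z -> {for z, continuous cinv} }.

Definition cimg (R : realType) (T : topologicalType) (n : nat)
  (c : chart R T n) : set 'rV[R]_n := c @` cdom c.

(* An n-dimensional smooth manifold, given by a smooth atlas (indexed by       *)
(* [mindex]) and, at every point p, a chart [mpref p] of this atlas around p;  *)
(* [mpref] trivializes the tangent space at p (see [tangent]) and is otherwise *)
(* just a witness that the charts cover the manifold.                          *)
Record manifold (R : realType) (n : nat) := Manifold {
  mcarrier :> topologicalType ;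
  mindex : Type ;
  mchart : mindex -> chart R mcarrier n ;
  mpref : mcarrier -> mindex ;
  mpref_dom : forall p, cdom (mchart (mpref p)) p ;
  mcompatible : forall i j,
    smooth_on (mchart i @` (cdom (mchart i) `&` cdom (mchart j)))
              (mchart j \o cinv (mchart i)) ;
  mhausdorff : hausdorff_space mcarrier ;
  msecond_countable : @second_countable mcarrier }.

Arguments mchart {R n} m i.
Arguments mpref {R n} m p.
Arguments mpref_dom {R n} m p.

Definition chart_at (R : realType) (n : nat) (M : manifold R n) (p : M) :=
  mchart M (mpref M p).

(* A tangent vector at p is represented by its coordinates in [chart_at p].    *)
Definition tangent (R : realType) (n : nat) (M : manifold R n) (p : M) :
  Type := 'rV[R]_n.

Section Maps.
Variables (R : realType) (m n : nat) (M : manifold R m) (N : manifold R n).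

Definition smooth_fun (w : M -> R) : Prop :=
  forall i, smooth_on (cimg (mchart M i)) (w \o cinv (mchart M i) : _ -> R^o).

Definition smooth_map (f : M -> N) : Prop :=
  continuous f /\
  forall i j,
    smooth_on (mchart M i @` (cdom (mchart M i) `&` f @^-1` cdom (mchart N j)))
              (mchart N j \o f \o cinv (mchart M i)).

Definition tangent_map (f : M -> N) (p : M) (u : tangent p) : tangent (f p) :=
  'd (chart_at (f p) \o f \o cinv (chart_at p)) (chart_at p p) u.

End Maps.

Definition diffeomorphism (R : realType) (m n : nat) (M : manifold R m)
    (N : manifold R n) (f : M -> N) : Prop :=
  smooth_map f /\
  exists f' : N -> M, [/\ smooth_map f', cancel f f' & cancel f' f].

(* The tangent vector at the point of coordinates z in the chart [mchart M i]  *)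
(* whose components in this chart are a; for [a] in the standard basis these   *)
(* are the coordinate vector fields of the chart.                              *)
Definition coord_vector (R : realType) (n : nat) (M : manifold R n)
    (i : mindex M) (z a : 'rV[R]_n) : tangent (cinv (mchart M i) z) :=
  'd (chart_at (cinv (mchart M i) z) \o cinv (mchart M i)) z a.

(* Smooth nondegenerate symmetric (0,2)-tensor fields.  Smoothness is that of  *)
(* the components of the tensor in every chart.  The index of the bilinear     *)
(* forms is locally constant; it is not required to be the same on different   *)
(* connected components.                                                       *)
Record pseudo_metric (R : realType) (n : nat) (M : manifold R n) :=
  PseudoMetric {
  pm_form :> forall p : M, tangent p -> tangent p -> R ;
  pm_linear : forall (p : M) (a : R) (u v z : 'rV[R]_n),
    pm_form (p := p) (a *: u + v) z = a * pm_form (p := p) u z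
                                      + pm_form (p := p) v z ;
  pm_sym : forall (p : M) (u v : tangent p), pm_form u v = pm_form v u ;
  pm_nondegenerate : forall (p : M) (u : 'rV[R]_n),
    (forall v : tangent p, pm_form (p := p) u v = 0) -> u = 0 ;
  pm_smooth : forall (i : mindex M) (a b : 'rV[R]_n),
    smooth_on (cimg (mchart M i))
      (fun z => pm_form (coord_vector i z a) (coord_vector i z b) : R^o) }.

Definition is_isometry (R : realType) (m n : nat) (M : manifold R m)
    (N : manifold R n) (g : pseudo_metric M) (g' : pseudo_metric N)
    (f : M -> N) : Prop :=
  diffeomorphism f /\
  forall (p : M) (u v : tangent p),
    g' (f p) (tangent_map f u) (tangent_map f v) = g p u v.

Section SmoothTheory.
Variable R : realType.
Implicit Types V W X : normedModType R.

Lemma near_eq_diff V W (f g : V -> W) (x : V) :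
  (\forall y \near x, f y = g y) -> differentiable f x ->
  differentiable g x /\ 'd g x = 'd f x :> (V -> W).
Proof.
move=> fg df.
suff H : g \o shift x = cst (g x) + 'd f x +o_ 0 id.
  have E := diff_unique (diff_continuous df) H; split=> //.
  by apply/diff_locallyP; rewrite E; split => //; exact: diff_continuous.
have /eqaddoP Hf := diff_locally df.
have fgx := nbhs_singleton fg.
apply/eqaddoP => e e0; have := Hf e e0.
rewrite (near_shift 0) in fg; move: fg; apply: filterS2 => y /=.
by rewrite !fctE /= subr0 fgx => ->.
Qed.

Lemma open_near_diff V W (U : set V) (f g : V -> W) (x : V) :
  open U -> {in U, f =1 g} -> U x -> differentiable f x ->
  differentiable g x /\ 'd g x = 'd f x :> (V -> W).
Proof.
move=> oU fg Ux; apply: near_eq_diff.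
by apply: filterS (open_nbhs_nbhs (conj oU Ux)) => y Uy; apply: fg; rewrite inE.
Qed.

Lemma Ck_ext k V W (U : set V) (f g : V -> W) :
  open U -> {in U, f =1 g} -> Ck k U f -> Ck k U g.
Proof.
move=> oU; elim: k f g => [|k IH] f g fg /=.
  move=> cf x Ux; have fgx : f x = g x by apply: fg; rewrite inE.
  rewrite /prop_for /continuous_at -fgx; apply: cvg_trans (cf x Ux).
  apply: near_eq_cvg.
  by apply: filterS (open_nbhs_nbhs (conj oU Ux)) => y Uy; apply: fg; rewrite inE.
move=> [df Cf]; split=> [x Ux|v].
  by have [] := open_near_diff oU fg Ux (df x Ux).
apply: IH (Cf v) => x /[!inE] Ux.
by have [_ ->] := open_near_diff oU fg Ux (df x Ux).
Qed.

Lemma Ck_sub k V W (U U' : set V) (f : V -> W) :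
  U' `<=` U -> Ck k U f -> Ck k U' f.
Proof.
move=> UU; elim: k f => [|k IH] f /= H; first by move=> x /UU; apply: H.
by case: H => df Cf; split=> [x /UU /df //|v]; apply: IH.
Qed.

Lemma CkW k V W (U : set V) (f : V -> W) : Ck k.+1 U f -> Ck k U f.
Proof.
elim: k f => [|k IH] f [df Cf].
  by move=> x Ux; apply: differentiable_continuous; exact: df.
by split=> // v; apply: IH.
Qed.

Lemma CkD k V W (U : set V) (f g : V -> W) : open U ->
  Ck k U f -> Ck k U g -> Ck k U (f \+ g).
Proof.
move=> oU; elim: k f g => [|k IH] f g /=.
  by move=> cf cg x Ux; apply: continuousD; [exact: cf|exact: cg].
move=> [df Cf] [dg Cg]; split=> [x Ux|v].
  by apply: differentiableD; [exact: df|exact: dg].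
apply: Ck_ext (IH _ _ (Cf v) (Cg v)) => // x /[!inE] Ux /=.
have -> : (f \+ g) = f + g :> (V -> W) by [].
by rewrite diffD //; [exact: df|exact: dg].
Qed.

Lemma CkM k V (U : set V) (f g : V -> R^o) : open U ->
  Ck k U f -> Ck k U g -> Ck k U (fun x => f x * g x : R^o).
Proof.
move=> oU; elim: k f g => [|k IH] f g /=.
  by move=> cf cg x Ux; apply: (@continuousM R V f g); [exact: cf|exact: cg].
move=> Hf Hg.
have Cf' := CkW Hf; have Cg' := CkW Hg.
move: Hf Hg => [df Cf] [dg Cg]; split=> [x Ux|v].
  by apply: (@differentiableM _ _ f g); [exact: df|exact: dg].
apply: Ck_ext (CkD _ (IH _ _ Cf' (Cg v)) (IH _ _ Cg' (Cf v))) => // x /[!inE] Ux /=.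
by rewrite (@diffM _ _ f g) //; [exact: df|exact: dg].
Qed.

Lemma Ck_lin_comp k V W X (U : set V) (f : V -> W) (A : {linear W -> X}) :
  open U -> continuous A -> Ck k U f -> Ck k U (A \o f).
Proof.
move=> oU cA; elim: k f => [|k IH] f /=.
  by move=> cf x Ux; apply: continuous_comp; [exact: cf|exact: cA].
move=> [df Cf]; split=> [x Ux|v].
  by apply: differentiable_comp; [exact: df|exact: linear_differentiable].
apply: Ck_ext (IH _ (Cf v)) => // x /[!inE] Ux /=.
rewrite (@diff_comp _ _ _ _ f A) /=; [|exact: df|exact: linear_differentiable].
by rewrite diff_lin.
Qed.

Lemma Ck_comp_lin k V W X (U : set V) (f : V -> W) (A : {linear X -> V}) :
  open U -> continuous A -> Ck k U f -> Ck k (A @^-1` U) (f \o A).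
Proof.
move=> oU cA; elim: k f => [|k IH] f /=.
  by move=> cf x Ux; apply: continuous_comp; [exact: cA|exact: cf].
move=> [df Cf]; split=> [x Ux|v].
  by apply: differentiable_comp; [exact: linear_differentiable|exact: df].
have oAU : open (A @^-1` U) by apply: open_comp => // x _; exact: cA.
apply: Ck_ext (IH _ (Cf (A v))) => // x /[!inE] Ux /=.
rewrite (@diff_comp _ _ _ _ A f) /=; [|exact: linear_differentiable|exact: df].
by rewrite diff_lin.
Qed.

Lemma lin_diff_lin V W X (Y : normedModType R) (f : V -> W)
    (A : {linear X -> V}) (B : {linear W -> Y}) (z u : X) :
  continuous A -> continuous B -> differentiable f (A z) ->
  differentiable (B \o (f \o A)) z /\
  'd (B \o (f \o A)) z u = B ('d f (A z) (A u)).
Proof.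
move=> cA cB df.
have dfA : differentiable (f \o A) z.
  by apply: differentiable_comp => //; exact: linear_differentiable.
split; first by apply: differentiable_comp => //; exact: linear_differentiable.
rewrite (@diff_comp _ _ _ _ (f \o A) B) //; last exact: linear_differentiable.
rewrite diff_lin //= (@diff_comp _ _ _ _ A f) //; last first.
  exact: linear_differentiable.
by rewrite diff_lin.
Qed.

End SmoothTheory.

Section RowMx.
Variables (R : realType) (m n : nat).

Lemma row_mx_continuous :
  continuous (fun p : 'rV[R]_m * 'rV[R]_n => row_mx p.1 p.2).
Proof.
move=> [u v] A [P PM sPA].
exists ([set u' : 'rV[R]_m | forall i j, P i (lshift n j) (u' i j)],
        [set v' : 'rV[R]_n | forall i j, P i (rshift m j) (v' i j)]); first split.
- exists (fun i j => P i (lshift n j)) => // i j.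
  by have := PM i (lshift n j); rewrite row_mxEl.
- exists (fun i j => P i (rshift m j)) => // i j.
  by have := PM i (rshift m j); rewrite row_mxEr.
move=> [u' v'] /= [Pu Pv]; apply: sPA => i j.
by case: (split_ordP j) => k ->; rewrite ?row_mxEl ?row_mxEr.
Qed.

Definition rowl (u : 'rV[R]_m) : 'rV[R]_(m + n) := row_mx u 0.
Definition rowr (v : 'rV[R]_n) : 'rV[R]_(m + n) := row_mx 0 v.

Lemma rowl_linear : linear rowl.
Proof. by move=> a u v; rewrite /rowl scale_row_mx add_row_mx scaler0 addr0. Qed.

Lemma rowr_linear : linear rowr.
Proof. by move=> a u v; rewrite /rowr scale_row_mx add_row_mx scaler0 addr0. Qed.

HB.instance Definition _ := GRing.isLinear.Build _ _ _ _ rowl rowl_linear.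
HB.instance Definition _ := GRing.isLinear.Build _ _ _ _ rowr rowr_linear.

Lemma cvg_row_mx (T : Type) (F : set_system T) (FF : Filter F)
    (f : T -> 'rV[R]_m) (g : T -> 'rV[R]_n) (u : 'rV[R]_m) (v : 'rV[R]_n) :
  f @ F --> u -> g @ F --> v -> (fun t => row_mx (f t) (g t)) @ F --> row_mx u v.
Proof.
move=> fu gv.
exact: (cvg_comp _ _ (cvg_pair fu gv) (@row_mx_continuous (u, v))).
Qed.

Lemma rowl_continuous : continuous rowl.
Proof.
move=> u; apply: (@cvg_row_mx _ (nbhs u) _ id (fun=> 0)); first exact: cvg_id.
exact: cvg_cst.
Qed.

Lemma rowr_continuous : continuous rowr.
Proof.
move=> v; apply: (@cvg_row_mx _ (nbhs v) _ (fun=> 0) id); last exact: cvg_id.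
exact: cvg_cst.
Qed.

Lemma row_mxE (u : 'rV[R]_m) (v : 'rV[R]_n) : row_mx u v = rowl u + rowr v.
Proof. by rewrite /rowl /rowr add_row_mx addr0 add0r. Qed.

End RowMx.

Section ProductMap.
Variables (R : realType) (m n m' n' : nat).
Variables (U : set 'rV[R]_m) (V : set 'rV[R]_n).
Hypotheses (oU : open U) (oV : open V).
Variables (f : 'rV[R]_m -> 'rV[R]_m') (g : 'rV[R]_n -> 'rV[R]_n').

Let UV : set 'rV[R]_(m + n) := lsubmx @^-1` U `&` rsubmx @^-1` V.
Let fg (z : 'rV[R]_(m + n)) := row_mx (f (lsubmx z)) (g (rsubmx z)).

Lemma open_lsubmx : open (lsubmx @^-1` U : set 'rV[R]_(m + n)).
Proof. by apply: open_comp => // x _; exact: continuous_lsubmx. Qed.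

Lemma open_rsubmx : open (rsubmx @^-1` V : set 'rV[R]_(m + n)).
Proof. by apply: open_comp => // x _; exact: continuous_rsubmx. Qed.

Lemma open_sum_set : open UV.
Proof. by apply: openI; [exact: open_lsubmx|exact: open_rsubmx]. Qed.

Lemma smooth_on_lsubmx (W : normedModType R) (h : 'rV[R]_m -> W) :
  smooth_on U h -> smooth_on UV (h \o lsubmx).
Proof.
move=> sh k; apply: (Ck_sub (U := lsubmx @^-1` U)) => [z []//|].
by apply: Ck_comp_lin (sh k) => //; exact: continuous_lsubmx.
Qed.

Lemma smooth_on_rsubmx (W : normedModType R) (h : 'rV[R]_n -> W) :
  smooth_on V h -> smooth_on UV (h \o rsubmx).
Proof.
move=> sh k; apply: (Ck_sub (U := rsubmx @^-1` V)) => [z []//|].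
by apply: Ck_comp_lin (sh k) => //; exact: continuous_rsubmx.
Qed.

Lemma smooth_on_row_mx : smooth_on U f -> smooth_on V g -> smooth_on UV fg.
Proof.
move=> sf sg k.
have -> : fg = (@rowl R m' n' \o (f \o lsubmx)) \+ (@rowr R m' n' \o (g \o rsubmx)).
  by apply/funext => z /=; rewrite -row_mxE.
have oUV := open_sum_set.
apply: CkD => //; apply: Ck_lin_comp => //.
- exact: rowl_continuous.
- exact: smooth_on_lsubmx.
- exact: rowr_continuous.
- exact: smooth_on_rsubmx.
Qed.

Lemma diff_row_mx z u : differentiable f (lsubmx z) ->
  differentiable g (rsubmx z) ->
  'd fg z u = row_mx ('d f (lsubmx z) (lsubmx u)) ('d g (rsubmx z) (rsubmx u)).
Proof.
move=> df dg.
have [dl El] := lin_diff_lin u (@continuous_lsubmx R 1 m n)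
  (@rowl_continuous R m' n') df.
have [dr Er] := lin_diff_lin u (@continuous_rsubmx R 1 m n)
  (@rowr_continuous R m' n') dg.
have -> : fg = (@rowl R m' n' \o (f \o lsubmx)) + (@rowr R m' n' \o (g \o rsubmx)).
  by apply/funext => y; rewrite fctE -row_mxE.
by rewrite diffD // row_mxE -El -Er.
Qed.

End ProductMap.

Section ProductManifold.
Variables (R : realType) (m n : nat).

Lemma open_prodset (S T : topologicalType) (A : set S) (B : set T) :
  open A -> open B -> open (A `*` B).
Proof.
move=> oA oB; rewrite openE => -[x y] [/= Ax By].
by exists (A, B) => //; split; exact: open_nbhs_nbhs.
Qed.

Section ProductChart.
Variables (S T : topologicalType) (c : chart R S m) (d : chart R T n).

Definition prod_cfun (p : S * T) : 'rV[R]_(m + n) := row_mx (c p.1) (d p.2).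
Definition prod_cinv (z : 'rV[R]_(m + n)) : S * T :=
  (cinv c (lsubmx z), cinv d (rsubmx z)).

Lemma prod_image (A : set S) (B : set T) :
  prod_cfun @` (A `*` B) = lsubmx @^-1` (c @` A) `&` rsubmx @^-1` (d @` B).
Proof.
apply/seteqP; split => [_ [[x y] [/= Ax By] <-]|z [[x Ax xz] [y By yz]]].
  by split; rewrite /prod_cfun /= ?row_mxKl ?row_mxKr; [exists x|exists y].
by exists (x, y) => //; rewrite /prod_cfun /= xz yz hsubmxK.
Qed.

Lemma prod_cdom_open : open (cdom c `*` cdom d).
Proof. by apply: open_prodset; exact: cdom_open. Qed.

Lemma prod_cimg_open : open (prod_cfun @` (cdom c `*` cdom d)).
Proof. by rewrite prod_image; apply: open_sum_set; exact: cimg_open. Qed.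

Lemma prod_cfunK p : (cdom c `*` cdom d) p -> prod_cinv (prod_cfun p) = p.
Proof.
case: p => x y [/= cx dy].
by rewrite /prod_cinv /prod_cfun row_mxKl row_mxKr /= !cfunK.
Qed.

Lemma prod_cfun_continuous p :
  (cdom c `*` cdom d) p -> {for p, continuous prod_cfun}.
Proof.
case: p => x y [/= cx dy].
have f1 : (fst : S * T -> S) @ (x, y) --> x by exact: cvg_fst.
have f2 : (snd : S * T -> T) @ (x, y) --> y by exact: cvg_snd.
exact: cvg_row_mx (cvg_comp _ _ f1 (cfun_continuous cx))
  (cvg_comp _ _ f2 (cfun_continuous dy)).
Qed.

Lemma prod_cinv_continuous z :
  (prod_cfun @` (cdom c `*` cdom d)) z -> {for z, continuous prod_cinv}.
Proof.
rewrite prod_image => -[zc zd].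
have cl : (cinv c \o lsubmx) @ z --> cinv c (lsubmx z).
  apply: continuous_comp; first exact: continuous_lsubmx.
  exact: cinv_continuous zc.
have cr : (cinv d \o rsubmx) @ z --> cinv d (rsubmx z).
  apply: continuous_comp; first exact: continuous_rsubmx.
  exact: cinv_continuous zd.
exact: cvg_pair cl cr.
Qed.

Definition prod_chart : chart R (S * T)%type (m + n) :=
  Chart prod_cdom_open prod_cimg_open prod_cfunK prod_cfun_continuous
        prod_cinv_continuous.

End ProductChart.

Lemma open_chart_image (k : nat) (T : topologicalType) (c : chart R T k)
    (A : set T) :
  open A -> open (c @` (cdom c `&` A)).
Proof.
move=> oA.
have -> : c @` (cdom c `&` A) = cimg c `&` cinv c @^-1` A.
  apply/seteqP; split => [_ [p [cp Ap] <-]|_ [[p cp <-]]] /=.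
    by split; [exists p|rewrite /= cfunK].
  by rewrite cfunK // => Ap; exists p.
rewrite openE => z [cz Az].
rewrite /interior; apply: filterI.
  by apply: open_nbhs_nbhs; split=> //; exact: cimg_open.
by apply: (cinv_continuous cz); apply: open_nbhs_nbhs.
Qed.

Lemma hausdorff_prod (S T : topologicalType) :
  hausdorff_space S -> hausdorff_space T -> hausdorff_space (S * T)%type.
Proof.
move=> hS hT [x y] [x' y'] xy; congr pair.
  apply: hS => A B nA nB.
  have [||[a b] [[Aa _] [Ba _]]] := xy (A `*` setT) (B `*` setT).
  - by exists (A, setT) => //; split => //; exact: filterT.
  - by exists (B, setT) => //; split => //; exact: filterT.
  by exists a.
apply: hT => A B nA nB.
have [||[a b] [[_ Ab] [_ Bb]]] := xy (setT `*` A) (setT `*` B).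
- by exists (setT, A) => //; split => //; exact: filterT.
- by exists (setT, B) => //; split => //; exact: filterT.
by exists b.
Qed.

Lemma second_countable_prod (S T : topologicalType) :
  @second_countable S -> @second_countable T ->
  @second_countable (S * T)%type.
Proof.
move=> [A cA [oA bA]] [B cB [oB bB]].
exists ((fun P : set S * set T => P.1 `*` P.2) @` (A `*` B)).
  by apply: (sub_countable (card_image_le _ _)); exact: countableX.
split=> [_ [[P Q] [/= AP BQ] <-]|[x y] C [[P Q] [/= xP yQ] sC]].
  by apply: open_prodset; [exact: oA|exact: oB].
have [P' [AP' P'x] sP] := bA x P xP; have [Q' [BQ' Q'y] sQ] := bB y Q yQ.
exists (P' `*` Q'); first by split => //; exists (P', Q').
by move=> [u v] [/= /sP Pu /sQ Qv]; apply: sC.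
Qed.

Lemma prod_compatible (M : manifold R m) (N : manifold R n)
    (i j : mindex M * mindex N) :
  let c (k : mindex M * mindex N) := prod_chart (mchart M k.1) (mchart N k.2) in
  smooth_on (c i @` (cdom (c i) `&` cdom (c j))) (c j \o cinv (c i)).
Proof.
move=> c.
have -> : cdom (c i) `&` cdom (c j) =
    (cdom (mchart M i.1) `&` cdom (mchart M j.1)) `*`
    (cdom (mchart N i.2) `&` cdom (mchart N j.2)).
  by apply/seteqP; split => [[x y] [[? ?] [? ?]]|[x y] [[? ?] [? ?]]].
rewrite prod_image.
apply: (smooth_on_row_mx _ _ (@mcompatible _ _ M i.1 j.1)
                             (@mcompatible _ _ N i.2 j.2));
  by apply: open_chart_image; exact: cdom_open.
Qed.

(* By the choice of the charts around the points, the tangent space at (x, y)  *)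
(* is, on the nose, the direct sum of those at x and y: [lsubmx] and [rsubmx]  *)
(* are the differentials of the two projections.                               *)
Definition prod_manifold (M : manifold R m) (N : manifold R n) :
    manifold R (m + n) :=
  @Manifold R (m + n) (M * N)%type (mindex M * mindex N)
    (fun k => prod_chart (mchart M k.1) (mchart N k.2))
    (fun p => (mpref M p.1, mpref N p.2))
    (fun p => conj (mpref_dom M p.1) (mpref_dom N p.2))
    (@prod_compatible M N)
    (hausdorff_prod (@mhausdorff R m M) (@mhausdorff R n N))
    (second_countable_prod (@msecond_countable R m M)
                           (@msecond_countable R n N)).

End ProductManifold.

Lemma differentiable_coord_vector (R : realType) (n : nat) (M : manifold R n)
    (i : mindex M) (z : 'rV[R]_n) : cimg (mchart M i) z ->
  differentiable (chart_at (cinv (mchart M i) z) \o cinv (mchart M i)) z.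
Proof.
move=> [q iq <-]; rewrite cfunK //.
have [+ _] := mcompatible i (mpref M q) 1.
by apply; exists q => //; split=> //; exact: mpref_dom.
Qed.

Section Warped.
Variables (R : realType) (l n : nat) (L : manifold R l) (N : manifold R n).
Variables (h : pseudo_metric L) (g : pseudo_metric N) (w : L -> R).

(* The metric h_x (+) w(x) g_y at p = (x, y).                                  *)
Definition warped_form (p : prod_manifold L N) (u v : tangent p) : R :=
  h p.1 (lsubmx u) (lsubmx v) + w p.1 * g p.2 (rsubmx u) (rsubmx v).

Lemma warped_linear (p : prod_manifold L N) (a : R)
    (u v z : 'rV[R]_(l + n)) :
  warped_form (p := p) (a *: u + v) z =
  a * warped_form (p := p) u z + warped_form (p := p) v z.
Proof.
rewrite /warped_form !linearP !pm_linear /=.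
by rewrite !mulrDr !mulrA (mulrC (w _) a) addrACA.
Qed.

Lemma warped_sym (p : prod_manifold L N) (u v : tangent p) :
  warped_form u v = warped_form v u.
Proof. by rewrite /warped_form pm_sym (pm_sym g). Qed.

Lemma pm_form0 (k : nat) (M : manifold R k) (q : pseudo_metric M) (p : M)
  (u : tangent p) : q p u (0 : 'rV[R]_k) = 0.
Proof.
by rewrite pm_sym -[X in q p X _](subrr (0 : 'rV[R]_k)) -scaleN1r addrC
  pm_linear mulN1r addNr.
Qed.

Hypothesis w_gt0 : forall x, 0 < w x.

Lemma warped_nondegenerate (p : prod_manifold L N) (u : 'rV[R]_(l + n)) :
  (forall v : tangent p, warped_form (p := p) u v = 0) -> u = 0.
Proof.
move=> H; rewrite -[u]hsubmxK.
have -> : lsubmx u = 0.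
  apply: (@pm_nondegenerate _ _ _ h p.1) => v.
  have := H (row_mx v 0); rewrite /warped_form row_mxKl row_mxKr.
  by rewrite pm_form0 mulr0 addr0.
have -> : rsubmx u = 0.
  apply: (@pm_nondegenerate _ _ _ g p.2) => v.
  have := H (row_mx 0 v); rewrite /warped_form row_mxKl row_mxKr.
  rewrite pm_form0 add0r => /eqP; rewrite mulf_eq0 gt_eqF ?w_gt0 //=.
  by move/eqP.
exact: row_mx0.
Qed.

Hypothesis w_smooth : smooth_fun w.

Lemma warped_smooth (k : mindex (prod_manifold L N)) (a b : 'rV[R]_(l + n)) :
  smooth_on (cimg (mchart (prod_manifold L N) k))
    (fun z => warped_form (coord_vector k z a) (coord_vector k z b) : R^o).
Proof.
case: k => i j.
have E : cimg (mchart (prod_manifold L N) (i, j)) =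
    lsubmx @^-1` (cimg (mchart L i)) `&` rsubmx @^-1` (cimg (mchart N j)).
  exact: prod_image.
have oi : open (cimg (mchart L i)) by exact: cimg_open.
have oj : open (cimg (mchart N j)) by exact: cimg_open.
have oU := open_sum_set oi oj.
have cE z c : cimg (mchart (prod_manifold L N) (i, j)) z ->
    coord_vector (M := prod_manifold L N) (i, j) z c =
    row_mx (coord_vector i (lsubmx z) (lsubmx c))
           (coord_vector j (rsubmx z) (rsubmx c)).
  rewrite E => -[zi zj].
  by apply: diff_row_mx; exact: differentiable_coord_vector.
pose H (z : 'rV[R]_l) : R^o :=
  h _ (coord_vector i z (lsubmx a)) (coord_vector i z (lsubmx b)).
pose G (z : 'rV[R]_n) : R^o :=
  g _ (coord_vector j z (rsubmx a)) (coord_vector j z (rsubmx b)).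
pose W (z : 'rV[R]_l) : R^o := w (cinv (mchart L i) z).
move=> k; rewrite E.
apply: (Ck_ext (f := (H \o lsubmx) \+
  (fun z => (W \o lsubmx) z * (G \o rsubmx) z : R^o))) => //.
  move=> z; rewrite inE -E => zU; rewrite /warped_form !cE //.
  by rewrite !row_mxKl !row_mxKr.
apply: CkD => //; last apply: CkM => //.
- by apply: smooth_on_lsubmx => //; exact: pm_smooth.
- by apply: smooth_on_lsubmx => //; exact: w_smooth.
- by apply: smooth_on_rsubmx => //; exact: pm_smooth.
Qed.

Definition warped_metric : pseudo_metric (prod_manifold L N) :=
  PseudoMetric warped_linear warped_sym warped_nondegenerate warped_smooth.

End Warped.

Definition trivial_extension (S T : Type) (f : T -> T) (p : S * T) : S * T :=
  (p.1, f p.2).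

(* Main.v *)
Require Import Defs.
From HB Require Import structures.
From mathcomp Require Import all_boot all_order all_algebra.
From mathcomp Require Import all_classical all_reals all_analysis.
Import Order.TTheory GRing.Theory Num.Theory.
Import numFieldNormedType.Exports.

Local Open Scope classical_set_scope.
Local Open Scope ring_scope.

(** In the product charts the differential of the trivial extension at (x, y)
    is block diagonal, the identity on the L-block and df on the N-block.  So
    the pullback of the warped metric differs from that metric only in the term
    w(x) g, and w(x) can be cancelled. *)

Lemma continuous_trivial_extension {S T : topologicalType} {f : T -> T} :
  continuous f -> continuous (trivial_extension f : S * T -> S * T).
Proof.
move=> cf [x y].
have f1 : (fst : S * T -> S) @ (x, y) --> x by exact: cvg_fst.
have f2 : (snd : S * T -> T) @ (x, y) --> y by exact: cvg_snd.
exact: cvg_pair f1 (cvg_comp _ _ f2 (cf y)).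
Qed.

(** In product charts the map splits into a transition map of L, smooth by compatibility of the
    atlas, and a local expression of f. *)
Lemma smooth_trivial_extension {R : realType} {l n : nat} (L : manifold R l)
    {N : manifold R n} {f : N -> N} : smooth_map f ->
  smooth_map (M := prod_manifold L N) (N := prod_manifold L N)
    (trivial_extension f).
Proof.
move=> [cf sf]; split; first exact: continuous_trivial_extension.
move=> [i i'] [j j'] /=.
(* Regrouped factor by factor, the domain is a product set, so [prod_image] turns its image into the
   form required by [smooth_on_row_mx]. *)
have -> : (cdom (mchart L i) `*` cdom (mchart N i')) `&`
    trivial_extension f @^-1` (cdom (mchart L j) `*` cdom (mchart N j')) =
    (cdom (mchart L i) `&` cdom (mchart L j)) `*`
    (cdom (mchart N i') `&` f @^-1` cdom (mchart N j')).
  by apply/seteqP; split => [[x y] [[? ?] [? ?]]|[x y] [[? ?] [? ?]]].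
rewrite prod_image.
apply: (smooth_on_row_mx _ _ (@mcompatible _ _ L i j) (sf i' j')).
  by apply: open_chart_image; exact: cdom_open.
apply: open_chart_image; apply: open_comp => [x _|]; first exact: cf.
exact: cdom_open.
Qed.

Lemma diffeomorphism_trivial_extension {R : realType} {l n : nat}
    (L : manifold R l) {N : manifold R n} {f : N -> N} : diffeomorphism f ->
  diffeomorphism (M := prod_manifold L N) (N := prod_manifold L N)
    (trivial_extension f).
Proof.
move=> [sf [f' [sf' fK f'K]]]; split; first exact: smooth_trivial_extension.
exists (trivial_extension f'); split; first exact: smooth_trivial_extension.
  by move=> [x y]; rewrite /trivial_extension /= fK.
by move=> [x y]; rewrite /trivial_extension /= f'K.
Qed.

(** The composite is the identity only on the image of the chart; this image is open, so the germ at
    [c x], and hence the differential, is that of [id]. This gives the L-block of the tangent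
    map. *)
Lemma diff_chartK {R : realType} {n : nat} {T : topologicalType}
    (c : chart R T n) (x : T) : cdom c x ->
  differentiable (c \o cinv c) (c x) /\
  'd (c \o cinv c) (c x) = id :> ('rV[R]_n -> 'rV[R]_n).
Proof.
move=> cx.
have idE : \forall z \near c x, id z = (c \o cinv c) z.
  have cimgx : open_nbhs (c x) (c @` cdom c) by split; [exact: cimg_open|exists x].
  by apply: filterS (open_nbhs_nbhs cimgx) => _ [p cp <-] /=; rewrite cfunK.
have [dc ->] := near_eq_diff idE (ex_diff (f := id)).
by split=> //; rewrite diff_val.
Qed.

(** Smoothness read at order 1 in the preferred charts at [p] and [f p]. *)
Lemma differentiable_in_charts {R : realType} {m n : nat} {M : manifold R m}
    {N : manifold R n} {f : M -> N} (p : M) : smooth_map f ->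
  differentiable (chart_at (f p) \o f \o cinv (chart_at p)) (chart_at p p).
Proof.
move=> [_ sf]; have [+ _] := sf (mpref M p) (mpref N (f p)) 1.
by apply; exists p => //; split; exact: mpref_dom.
Qed.

(** The preferred chart at (x, f y) is the product of those at x and f y, so the local expression is
    a block map by computation and [diff_row_mx] applies. *)
Lemma tangent_map_trivial_extension {R : realType} {l n : nat}
    {L : manifold R l} {N : manifold R n} {f : N -> N}
    (p : prod_manifold L N) (u : tangent p) : smooth_map f ->
  tangent_map (M := prod_manifold L N) (N := prod_manifold L N)
    (trivial_extension f) u =
  row_mx (lsubmx u) (tangent_map f (p := p.2) (rsubmx u)).
Proof.
move=> sf.
have [dL EL] := diff_chartK _ _ (mpref_dom L p.1).
have dN := differentiable_in_charts p.2 sf.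
(* The identity on the L-block is rewritten as the differential of the chart round trip, which is
   what [diff_row_mx] produces. *)
rewrite -[lsubmx u in RHS]/(id (lsubmx u)) -EL /tangent_map.
have := @diff_row_mx R l n l n (chart_at p.1 \o cinv (chart_at p.1))
  (chart_at (f p.2) \o f \o cinv (chart_at p.2)) (chart_at p p) u.
by rewrite row_mxKl row_mxKr; apply.
Qed.

Theorem mainTheorem1 (R : realType) (l n : nat)
  (L : manifold R l) (h : pseudo_metric L)
  (N : manifold R n) (g : pseudo_metric N)
  (L_nonempty : exists x : L, True)
  (w : L -> R) (w_gt0 : forall x : L, 0 < w x) (w_smooth : smooth_fun w)
  (f : N -> N) (f_diffeo : diffeomorphism f) :
  is_isometry (warped_metric h g w_gt0 w_smooth)
              (warped_metric h g w_gt0 w_smooth)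
              (trivial_extension f)
  <-> is_isometry g g f.
Proof.
have [sf _] := f_diffeo.
split=> -[_ isof]; split=> //; last first.
- move=> p u v; rewrite !tangent_map_trivial_extension //=.
  by rewrite /warped_form !row_mxKl !row_mxKr isof.
- exact: diffeomorphism_trivial_extension.
(* Over an empty L the product is empty and the assumption on its metric would say nothing about
   g. *)
have [x _] := L_nonempty => y u v.
(* On vectors tangent to N the h-terms are equal, and both sides carry the same factor [w x] because
   the L-coordinate is fixed. *)
have := isof (x, y) (row_mx 0 u) (row_mx 0 v).
rewrite !tangent_map_trivial_extension //= /warped_form !row_mxKl !row_mxKr.
by move=> /addrI /mulfI; apply; rewrite gt_eqF.
Qed.
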